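(* The function $\nu_p(n)$ (for integer arguments $n\ge1$ and $p$ prime) can be represented by the arithmetic term $$\left\lfloor\frac{\gcd\left(n,p^{\lfloor\log_p(n)\rfloor+1}\right)^{\lfloor\log_p(n)\rfloor+3}\bmod\left(p^{\lfloor\log_p(n)\rfloor+3}-1\right)^2}{p^{\lfloor\log_p(n)\rfloor+3}-1}\right\rfloor;$$ that is, for every integer $n\ge1$ and every prime $p$, $\nu_p(n)$ equals the value of this expression.
   Context: $\nu_p(n)$ is the exponent of the prime $p$ in the prime factorization of $n$. An arithmetic term is an expression built from natural-number constants and the variables by the operations $x+y$, $\max(x-y,0)$, $\lfloor x/y\rfloor$, $x^y$ on $\mathbb N=\{0,1,2,\dots\}$ (with $0^0=1$, $\lfloor x/0\rfloor=0$). Products, remainders $x\bmod y$, $\gcd$ of positive integers, and $\lfloor\log_m(n)\rfloor$ (for $m\ge2$, $n\ge1$) are expressible by arithmetic terms and are used as abbreviations; ordinary subtraction is written in place of truncated subtraction for readability. *)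

(* Defs.v *)
(* Conventions: [logn p n] is the p-adic valuation of n (p prime, 0 < n);
   [trunc_log p n] is the integer part of log_p(n) (1 < p, 0 < n);
   subtraction on nat is truncated, as in arithmetic terms. *)
From mathcomp Require Import all_boot.

(* Main.v *)
Require Import Defs.
From mathcomp Require Import all_boot.

Set Implicit Arguments.
Unset Strict Implicit.
Unset Printing Implicit Defensive.

(** The gcd with a power of [p] whose exponent is at least the valuation [k]
    of [n] isolates the [p]-part [p ^ k] of [n] ([gcdn_pfactor]). What remains
    is to read an exponent off a power by arithmetic operations. Raising to
    the power [e = trunc_log p n + 3] gives [(p ^ k) ^ e = q ^ k] with
    [q = p ^ e], and since [q] is [1] modulo [q - 1], the binomial expansion
    modulo [(q - 1) ^ 2] stops after its linear term:
    [q ^ k = 1 + k * (q - 1)] ([expSn_mod_sqr]). Because [k <= trunc_log p n]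
    is smaller than [q - 1], the right-hand side is the actual remainder, and
    its quotient by [q - 1] is [k] ([expSn_mod_sqr_div]). *)

Lemma logn_le_trunc_log p n : prime p -> 0 < n -> logn p n <= trunc_log p n.
Proof.
move=> p_pr n_gt0; apply: trunc_log_max; first exact: prime_gt1.
by apply: dvdn_leq => //; exact: pfactor_dvdnn.
Qed.

Lemma gcdn_pfactor p n e :
  prime p -> 0 < n -> logn p n <= e -> gcdn n (p ^ e) = p ^ logn p n.
Proof.
move=> p_pr n_gt0 le_k_e.
have [m co_p_m def_n] := pfactor_coprime p_pr n_gt0.
rewrite {1}def_n -(subnK le_k_e) expnD -muln_gcdl.
by have /eqP-> : coprime m (p ^ (e - logn p n));
  rewrite ?mul1n // coprime_sym coprimeXl.
Qed.

(** Only the constant and linear terms of the binomial expansion survive. *)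
Lemma expSn_mod_sqr M k : M.+1 ^ k = 1 + k * M %[mod M ^ 2].
Proof.
elim: k => [|k IHk]; first by rewrite expn0.
rewrite expnS -modnMmr IHk modnMmr.
have -> : M.+1 * (1 + k * M) = k * M ^ 2 + (1 + k.+1 * M).
  rewrite mulSn mulnDr muln1 [M * (k * M)]mulnCA mulnn mulSn.
  by rewrite addnA addnC -!addnA [k * M + M]addnC.
by rewrite modnMDl.
Qed.

(** The bound [k < M] makes the linear term [1 + k * M] smaller than [M ^ 2],
    so that reduction leaves it unchanged, and [1 < M] makes the division
    discard the constant term. *)
Lemma expSn_mod_sqr_div M k :
  1 < M -> k < M -> (M.+1 ^ k %% M ^ 2) %/ M = k.
Proof.
move=> M_gt1 lt_k_M; have M_gt0 := ltnW M_gt1.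
rewrite expSn_mod_sqr modn_small.
  by rewrite addnC divnMDl // divn_small // addn0.
rewrite -mulnn; apply: (@leq_trans (k.+1 * M)); last by rewrite leq_mul2r lt_k_M orbT.
by rewrite mulSn ltn_add2r.
Qed.

Theorem theorem9p4 (n p : nat) (n_ge1 : 1 <= n) (p_prime : prime p) :
  logn p n =
    (gcdn n (p ^ (trunc_log p n + 1)) ^ (trunc_log p n + 3)
       %% (p ^ (trunc_log p n + 3) - 1) ^ 2)
    %/ (p ^ (trunc_log p n + 3) - 1).
Proof.
have le_k_L := logn_le_trunc_log p_prime n_ge1.
rewrite gcdn_pfactor ?(leq_trans le_k_L) ?leq_addr //.
rewrite -expnM mulnC expnM.
set L := trunc_log p n in le_k_L *.
have lt_e_q : L + 3 < p ^ (L + 3) by rewrite ltn_expl ?prime_gt1.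
have def_q : p ^ (L + 3) = (p ^ (L + 3) - 1).+1.
  by rewrite subn1 prednK // (leq_trans _ lt_e_q).
move: (p ^ (L + 3) - 1) def_q => M def_q.
rewrite def_q ltnS in lt_e_q *.
rewrite expSn_mod_sqr_div //.
  by apply: leq_trans lt_e_q; rewrite addnC.
by apply: leq_trans lt_e_q; rewrite addn3 ltnS (leq_trans le_k_L) // -addn2 leq_addr.
Qed.
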